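(* Let $q\geq 4$ be a natural number and let $U$ be a subset of the vertices of the Hamming graph $H(2,q)$ with $|U|\geq 3q+1$. Then the VC-dimension of $(U,n(U))$ is $3$. Moreover this bound is tight: for every $q\ge 4$ there is a subset $U$ of the vertices of $H(2,q)$ with $|U|=3q$ such that the VC-dimension of $(U,n(U))$ is less than $3$.
   Context: The Hamming graph $H(2,q)$ has vertex set $\mathbb Z_q^2$, with two vertices adjacent if and only if they differ in exactly one coordinate. For a vertex $x$, $n(x)$ denotes its neighborhood, the set of vertices adjacent to $x$ (so $x\notin n(x)$), and for a set $U$ of vertices $n(U)=\{n(u):u\in U\}$. A set $W\subseteq U$ is shattered by $n(U)$ if for every $S\subseteq W$ there is $u\in U$ with $n(u)\cap W=S$. The VC-dimension of $(U,n(U))$ is the size of the largest $W\subseteq U$ that is shattered by $n(U)$. *)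

(* Defs.v *)
From mathcomp Require Import all_boot all_order all_algebra.

Set Implicit Arguments.
Unset Strict Implicit.
Unset Printing Implicit Defensive.

(* ['Z_q] has q elements only for q >= 2. *)
Definition hamming2 (q : nat) : finType := ('Z_q * 'Z_q)%type.

(* [(+)] is exclusive or: the vertices differ in exactly one coordinate. *)
Definition hamming2_adj (q : nat) : rel (hamming2 q) :=
  fun x y => (x.1 != y.1) (+) (x.2 != y.2).

Definition nbhd (V : finType) (e : rel V) (x : V) : {set V} :=
  [set y | e x y].

(* Neighborhoods are taken in the whole graph, not in the subgraph induced
   on U. *)
Definition nbhds (V : finType) (e : rel V) (U : {set V}) : {set {set V}} :=
  [set nbhd e u | u in U].

Definition shattered (V : finType) (F : {set {set V}}) (W : {set V}) : bool :=
  [forall (S : {set V} | S \subset W), [exists N in F, N :&: W == S]].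

(* The maximum over an empty range is 0; this is only relevant when F is empty,
   since the empty set is shattered by any nonempty F. *)
Definition vcdim (V : finType) (X : {set V}) (F : {set {set V}}) : nat :=
  \max_(W : {set V} | (W \subset X) && shattered F W) #|W|.

(* Main.v *)
(** Call a point of [U] lonely in a direction if it is the only point of [U] on
    its line in that direction.  Let L (resp. L') be the number of column-lonely
    (resp. row-lonely) points, and suppose that no row has 4 points that are not
    column-lonely.  A row containing a row-lonely point has at most one point,
    so counting by rows gives |U| - L <= 3q - 2L'.  If the same holds for
    columns, adding the two bounds yields 2|U| <= 6q - L - L'.  Hence if
    |U| > 3q, some line contains 4 points x_1, ..., x_4 of [U], each with a
    further point y_i of [U] on the perpendicular line through x_i.  Then
    {x_1, x_2, x_3} is shattered: x_4 traces out all of it, x_i the complement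
    of {x_i}, y_i the singleton {x_i} and y_4 the empty set.

    Conversely, a shattered set of size at least 3 forces 4 points of [U] on one
    line; the set of all (i, i + d) with d = 0, 1, 2 has only 3 points on each
    line. *)
Require Import Defs.
From mathcomp Require Import all_boot all_order all_algebra.
From mathcomp Require Import zify.

(* Keeping the two coordinates as functions makes exchanging rows and columns
   an exchange of [f] and [g]. *)
Definition coordinates {V T : finType} (e : rel V) (f g : V -> T) : Prop :=
  injective (fun x => (f x, g x)) /\
  forall x y, e x y = (f x != f y) (+) (g x != g y).

Lemma coordinatesC {V T : finType} {e : rel V} {f g : V -> T} :
  coordinates e f g -> coordinates e g f.
Proof.
move=> [inj eE]; split=> [x y [gxy fxy]|x y]; last by rewrite eE addbC.
by apply: inj; rewrite /= fxy gxy.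
Qed.

Lemma coordinates_eq {V T : finType} {e : rel V} {f g : V -> T} {x y : V} :
  coordinates e f g -> f x = f y -> g x = g y -> x = y.
Proof. by move=> [inj _] fxy gxy; apply: inj; rewrite /= fxy gxy. Qed.

Lemma shattered_nbhdsP {V : finType} {e : rel V} {U W : {set V}} :
  reflect (forall S : {set V}, S \subset W ->
             exists2 u, u \in U & forall x, x \in W -> e u x = (x \in S))
          (shattered (nbhds e U) W).
Proof.
apply: (iffP forall_inP) => [sh S /sh /exists_inP[N /imsetP[u uU ->] /eqP NS]|sh S SW].
  by exists u => // x xW; rewrite -NS !inE xW andbT.
have [u uU uS] := sh S SW; apply/exists_inP; exists (nbhd e u); first exact: imset_f.
apply/eqP/setP=> x; rewrite !inE; case: (boolP (x \in W)) => xW.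
  by rewrite andbT uS.
by rewrite andbF; apply/esym/negbTE; apply: contra xW; apply/subsetP.
Qed.

(** * Counting lonely points *)

Definition lonely {V T : finType} (g : V -> T) (U : {set V}) : {set V} :=
  [set x in U | [forall y in U, (g y == g x) ==> (y == x)]].

Lemma lonelyPn {V T : finType} {g : V -> T} {U : {set V}} {x : V} :
  x \in U -> x \notin lonely g U ->
  exists y, [/\ y \in U, g y = g x & y != x].
Proof.
move=> xU; rewrite inE xU /= negb_forall => /existsP[y].
by rewrite !negb_imply => /and3P[yU /eqP gy yx]; exists y.
Qed.

Lemma lonely_eq {V T : finType} {g : V -> T} {U : {set V}} {x y : V} :
  x \in lonely g U -> y \in U -> g y = g x -> y = x.
Proof.
rewrite inE => /andP[_ /forall_inP h] yU gyx.
by have := h y yU; rewrite gyx eqxx => /eqP.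
Qed.

(** Rows are the fibres of [f] and columns those of [g]; each row is charged at most 3. *)
Lemma card_nonlonely_le {V T : finType} (f g : V -> T) (U : {set V}) :
  (forall r, #|[set x in U :\: lonely g U | f x == r]| <= 3) ->
  #|U :\: lonely g U| + 2 * #|lonely f U| <= 3 * #|T|.
Proof.
move=> le3.
have -> : #|lonely f U| = #|f @: lonely f U|.
  rewrite card_in_imset // => x y xL yL.
  by apply: lonely_eq yL _; move: xL; rewrite inE => /andP[].
have -> : #|U :\: lonely g U|
          = \sum_r #|[set x in U :\: lonely g U | f x == r]|.
  rewrite -sum1_card (partition_big f predT) //=.
  by apply: eq_bigr => r _; rewrite -sum1_card; apply: eq_bigl => x; rewrite !inE.
rewrite -[#|f @: _|]sum1_card [\sum_(r in _) 1]big_mkcond big_distrr -big_split /=.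
rewrite [3 * _]mulnC -sum_nat_const; apply: leq_sum => r _.
(* The row of an [f]-lonely point [z] contributes at most 1 + 2, any other row at most 3 + 0. *)
case: imsetP => [[z zL ->]|_]; last by rewrite muln0 addn0.
rewrite muln1 (leq_add2r 2 _ 1) -(cards1 z); apply/subset_leq_card/subsetP => x.
by rewrite !inE => /andP[/andP[_ xU] /eqP /(lonely_eq zL xU) ->].
Qed.

Lemma exists_line_4_nonlonely {V T : finType} (f g : V -> T) (U : {set V}) :
  3 * #|T| < #|U| ->
  (exists r, 3 < #|[set x in U :\: lonely g U | f x == r]|) \/
  (exists r, 3 < #|[set x in U :\: lonely f U | g x == r]|).
Proof.
move=> big.
case: (boolP [exists r, 3 < #|[set x in U :\: lonely g U | f x == r]|]).
  by move/existsP; left.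
rewrite negb_exists => /forallP nf.
case: (boolP [exists r, 3 < #|[set x in U :\: lonely f U | g x == r]|]).
  by move/existsP; right.
rewrite negb_exists => /forallP ng.
have /card_nonlonely_le := fun r => etrans (leqNgt _ _) (nf r).
have /card_nonlonely_le := fun r => etrans (leqNgt _ _) (ng r).
have subU (h : V -> T) : lonely h U \subset U by apply/subsetP=> x; rewrite inE => /andP[].
rewrite !cardsD !(setIidPr (subU _)).
have := subset_leq_card (subU f); have := subset_leq_card (subU g).
lia.
Qed.

(** * Three shattered points on a line *)

Lemma adj_collinear {V T : finType} {e : rel V} {f g : V -> T} {x y : V} :
  coordinates e f g -> f x = f y -> e x y = (x != y).
Proof.
move=> co fxy; rewrite (co.2) fxy eqxx /=; congr negb.
by apply/eqP/eqP => [gxy|->//]; apply: coordinates_eq co fxy gxy.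
Qed.

Lemma line_4_nonlonely_shattered {V T : finType} {e : rel V} {f g : V -> T}
    {U : {set V}} {r : T} :
  coordinates e f g ->
  3 < #|[set x in U :\: lonely g U | f x == r]| ->
  exists W : {set V}, [/\ W \subset U, shattered (nbhds e U) W & #|W| = 3].
Proof.
move=> co; set P := [set x in _ | _] => P4.
have PU x : x \in P -> x \in U by rewrite !inE => /andP[/andP[]].
have Pf x : x \in P -> f x = r by rewrite inE => /andP[_ /eqP].
have PP x z : x \in P -> z \in P -> e x z = (x != z).
  by move=> /Pf fx /Pf fz; rewrite (adj_collinear co) ?fx ?fz.
(* The second point [y] with the same [g] as [x] lies off the line, so on that line it is adjacent
   only to the point sharing its [g], which is [x]. *)
have Py x : x \in P -> exists2 y, y \in U & forall z, z \in P -> e y z = (x == z).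
  move=> xP; have [|y [yU gy yx]] := lonelyPn (PU x xP) (_ : x \notin lonely g U).
    by move: xP; rewrite in_set in_setD => /andP[/andP[]].
  exists y => // z zP.
  have fy : f y != f x.
    by apply: contra yx => /eqP fy; apply/eqP/(coordinates_eq co fy gy).
  have fxz : f x = f z by rewrite !Pf.
  rewrite co.2 -fxz fy gy addTb negbK.
  by apply/eqP/eqP => [gxz|->//]; apply: coordinates_eq co fxz gxz.
have /card_geqP[s [us sz sP]] := P4.
case: s us sz sP => [|x1 [|x2 [|x3 [|x4 []]]]] // us _ sP.
have [x1P x2P x3P x4P] : [/\ x1 \in P, x2 \in P, x3 \in P & x4 \in P].
  by split; apply: sP; rewrite !inE eqxx ?orbT.
have [[y1 y1U y1E] [y2 y2U y2E]] := (Py x1 x1P, Py x2 x2P).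
have [[y3 y3U y3E] [y4 y4U y4E]] := (Py x3 x3P, Py x4 x4P).
move: us; rewrite /= !inE !negb_or => /and4P[/and3P[n12 n13 n14] /andP[n23 n24] n34 _].
exists [set x1; x2; x3]; split.
- by apply/subsetP=> x; rewrite !inE => /orP[/orP[]|] /eqP->; apply: PU.
- apply/shattered_nbhdsP => S _.
  suff [u uU [u1 u2 u3]] : exists2 u, u \in U &
      [/\ e u x1 = (x1 \in S), e u x2 = (x2 \in S) & e u x3 = (x3 \in S)].
    by exists u => // x; rewrite !inE => /orP[/orP[]|] /eqP->.
  case: (x1 \in S); case: (x2 \in S); case: (x3 \in S).
  + by exists x4; rewrite ?PU // !PP // !(eq_sym x4) n14 n24 n34.
  + by exists x3; rewrite ?PU // !PP // !(eq_sym x3) n13 n23 eqxx.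
  + by exists x2; rewrite ?PU // !PP // (eq_sym x2 x1) n12 n23 eqxx.
  + by exists y1 => //; rewrite !y1E // eqxx (negbTE n12) (negbTE n13).
  + by exists x1; rewrite ?PU // !PP // n12 n13 eqxx.
  + by exists y2 => //; rewrite !y2E // eqxx eq_sym (negbTE n12) (negbTE n23).
  + by exists y3 => //; rewrite !y3E // eqxx !(eq_sym x3) (negbTE n13) (negbTE n23).
  + by exists y4 => //; rewrite !y4E // !(eq_sym x4) (negbTE n14) (negbTE n24) (negbTE n34).
- by rewrite -setUA !cardsU1 cards1 !inE negb_or n12 n13 n23.
Qed.

(** * Constraints on shattered sets *)

(** Off their line, a common neighbor of [a] and [b] would share its [g] with both, forcing
    [a = b]. *)
Lemma adj_two_collinear {V T : finType} {e : rel V} {f g : V -> T} {a b v : V} :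
  coordinates e f g -> f a = f b -> a != b -> e v a -> e v b -> f v = f a.
Proof.
move=> co fab ab; rewrite !co.2 -fab.
case: eqP => //= _; rewrite !negbK => /eqP ga /eqP gb.
by case/eqP: ab; apply: coordinates_eq co fab _; rewrite -ga.
Qed.

(** Pigeonhole: each of the at least three points of [W] shares [f] or [g] with [u]. *)
Lemma adj_all_two_collinear {V T : finType} {e : rel V} {f g : V -> T} {u : V}
    {W : {set V}} :
  coordinates e f g -> 2 < #|W| -> {in W, forall x, e u x} ->
  (exists a b, [/\ a \in W, b \in W, a != b, f a = f u & f b = f u]) \/
  (exists a b, [/\ a \in W, b \in W, a != b, g a = g u & g b = g u]).
Proof.
move=> co W3 uW.
have : W \subset [set x in W | f x == f u] :|: [set x in W | g x == g u].
  apply/subsetP=> x xW; rewrite !inE xW /=; have := uW x xW; rewrite co.2.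
  by rewrite (eq_sym (f u)) (eq_sym (g u)); case: eqP; case: eqP.
move=> /subset_leq_card; rewrite cardsU => Wle.
have [] : 1 < #|[set x in W | f x == f u]| \/ 1 < #|[set x in W | g x == g u]| by lia.
  move=> /card_gt1P[a [b []]]; rewrite !inE => /andP[aW /eqP fa] /andP[bW /eqP fb] ab.
  by left; exists a, b.
move=> /card_gt1P[a [b []]]; rewrite !inE => /andP[aW /eqP fa] /andP[bW /eqP fb] ab.
by right; exists a, b.
Qed.

(** The four points are [a], [b], [u] and a vertex [v] cutting out [{a, b}]. A third point [c] of
    [W] separates [v] from [u], being adjacent to [u] only. *)
Lemma shattered_3_line {V T : finType} {e : rel V} {f g : V -> T}
    {U W : {set V}} {u a b : V} :
  coordinates e f g -> shattered (nbhds e U) W -> W \subset U -> 2 < #|W| ->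
  u \in U -> {in W, forall x, e u x} -> a \in W -> b \in W -> a != b ->
  f a = f u -> f b = f u -> 3 < #|[set x in U | f x == f u]|.
Proof.
move=> co /shattered_nbhdsP sh /subsetP WU W3 uU uW aW bW ab fa fb.
have ne x y : e x y -> y != x by apply: contraTneq => ->; rewrite co.2 !eqxx.
have [|c] := card_gt0P (_ : 0 < #|W :\: [set a; b]|).
  rewrite cardsD; have := subset_leq_card (subsetIr W [set a; b]).
  rewrite cards2 ab; lia.
rewrite !inE negb_or => /andP[/andP[ca cb] cW].
have [|v vU vE] := sh [set a; b].
  by apply/subsetP=> x; rewrite !inE => /orP[] /eqP->.
have [va vb] : e v a /\ e v b by rewrite !vE // !inE !eqxx orbT.
have vc : e v c = false by rewrite vE // !inE (negbTE ca) (negbTE cb).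
have fv : f v = f u by rewrite (adj_two_collinear co _ ab va vb) // fa.
have uv : u != v by apply: contraFneq vc => <-; apply: uW.
apply/card_geqP; exists [:: a; b; u; v]; split=> //=.
  by rewrite !inE !negb_or ab uv !ne // uW.
by move=> x; rewrite !inE => /or4P[] /eqP->;
  rewrite ?uU ?vU ?WU // ?fa ?fb ?fv eqxx.
Qed.

(** Two further points [c] and [d] of [W] would have to lie on the line of [a] and [b]. So would a
    vertex cutting out [{a, b}]; being adjacent to neither [c] nor [d], it would equal both. *)
Lemma card_shattered_le3 {V T : finType} {e : rel V} {f g : V -> T}
    {U W : {set V}} {u a b : V} :
  coordinates e f g -> shattered (nbhds e U) W ->
  {in W, forall x, e u x} -> a \in W -> b \in W -> a != b ->
  f a = f u -> f b = f u -> #|W| <= 3.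
Proof.
move=> co /shattered_nbhdsP sh uW aW bW ab fa fb; rewrite leqNgt; apply/negP => W4.
have fab : f a = f b by rewrite fa.
have [|c [d []]] := card_gt1P (_ : 1 < #|W :\: [set a; b]|).
  rewrite cardsD; have := subset_leq_card (subsetIr W [set a; b]).
  rewrite cards2 ab; lia.
rewrite !inE !negb_or => /andP[/andP[ca cb] cW] /andP[/andP[da db] dW] cd.
(* Only [z] itself can be adjacent to [a] and [b] but not to [z] when [z] is on
   their line; off that line, only [u] can be adjacent to [a], [b] and [z]. *)
have allonline z w : z \in W -> w \in W -> z != w -> w != a -> w != b ->
    f z = f u.
  move=> zW wW zw wa wb; apply/eqP/negPn/negP => fz.
  (* Leaving out [w] makes [v] differ from [u], which is adjacent to all of [W]. *)
  have [v vU vE] := sh (W :\ w) (subD1set _ _).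
  have fv : f v = f u.
    rewrite (@adj_two_collinear _ _ _ _ _ a b v co) // vE // !inE.
      by rewrite eq_sym wa.
    by rewrite eq_sym wb.
  have gz : g u = g z.
    by have := uW z zW; rewrite co.2 eq_sym fz /= negbK => /eqP.
  have gv : g v = g z.
    have : e v z by rewrite vE // !inE zw.
    by rewrite co.2 fv eq_sym fz /= negbK => /eqP.
  have vu : v = u by apply: coordinates_eq co fv _; rewrite gv.
  by have := vE w wW; rewrite vu uW // !inE eqxx.
have fc := allonline c d cW dW cd da db.
have dc : d != c by rewrite eq_sym.
have fd := allonline d c dW cW dc ca cb.
have abW : [set a; b] \subset W by apply/subsetP=> x; rewrite !inE => /orP[] /eqP->.
have [v vU vE] := sh [set a; b] abW.
have [va vb] : e v a /\ e v b by rewrite !vE // !inE !eqxx orbT.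
have vz z : z \in W -> z != a -> z != b -> f z = f u -> v = z.
  move=> zW za zb fz.
  have fv : f v = f z by rewrite (adj_two_collinear co fab ab va vb) fa.
  apply/eqP; rewrite -[_ == _]negbK -(adj_collinear co fv) vE //.
  by rewrite !inE negb_or za.
by case/eqP: cd; rewrite -(vz c) // -(vz d).
Qed.

(** * VC-dimension in the Hamming graph *)

Lemma hamming2_coordinates (q : nat) :
  coordinates (@hamming2_adj q) (fst : hamming2 q -> 'Z_q) (snd : hamming2 q -> 'Z_q).
Proof. by split=> // -[x1 x2] [y1 y2]. Qed.

Lemma card_shattered_hamming2 (q : nat) (U W : {set hamming2 q}) :
  shattered (nbhds (@hamming2_adj q) U) W -> #|W| <= 3.
Proof.
move=> sh; rewrite leqNgt; apply/negP => W4.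
(* Cutting out all of [W] gives a common neighbor [u]; two points of [W] then share a line with
   it. *)
have [u uU uW] := shattered_nbhdsP sh W (subxx _).
have co := @hamming2_coordinates q.
have uW' : {in W, forall x, hamming2_adj u x} by move=> x xW; rewrite uW.
have [[a [b [aW bW ab fa fb]]]|[a [b [aW bW ab fa fb]]]] :=
  adj_all_two_collinear co (ltnW W4) uW'.
  by have := card_shattered_le3 co sh uW' aW bW ab fa fb; rewrite leqNgt W4.
by have := card_shattered_le3 (coordinatesC co) sh uW' aW bW ab fa fb; rewrite leqNgt W4.
Qed.

Lemma vcdim_lines_le3 (q : nat) (U : {set hamming2 q}) :
  (forall r : 'Z_q, #|[set x in U | x.1 == r]| <= 3) ->
  (forall r : 'Z_q, #|[set x in U | x.2 == r]| <= 3) ->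
  vcdim U (nbhds (@hamming2_adj q) U) < 3.
Proof.
move=> U1 U2; apply/bigmax_leqP => W /andP[WU sh]; rewrite leqNgt; apply/negP => W3.
have [u uU uW] := shattered_nbhdsP sh W (subxx _).
have co := @hamming2_coordinates q.
have uW' : {in W, forall x, hamming2_adj u x} by move=> x xW; rewrite uW.
have [[a [b [aW bW ab fa fb]]]|[a [b [aW bW ab fa fb]]]] :=
  adj_all_two_collinear co W3 uW'.
  have := shattered_3_line co sh WU W3 uU uW' aW bW ab fa fb.
  by rewrite ltnNge U1.
have := shattered_3_line (coordinatesC co) sh WU W3 uU uW' aW bW ab fa fb.
by rewrite ltnNge U2.
Qed.

Lemma vcdim_hamming2_gt (q : nat) (hq : 1 < q) (U : {set hamming2 q}) :
  3 * q < #|U| -> vcdim U (nbhds (@hamming2_adj q) U) = 3.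
Proof.
move=> Ugt; apply/eqP; rewrite eqn_leq; apply/andP; split.
  by apply/bigmax_leqP => W /andP[_]; apply: card_shattered_hamming2.
have co := @hamming2_coordinates q.
have cardT : #|'Z_q| = q by rewrite card_ord Zp_cast.
have [W [WU sh W3]] : exists W : {set hamming2 q},
    [/\ W \subset U, shattered (nbhds (@hamming2_adj q) U) W & #|W| = 3].
  have [|[r r4]|[r r4]] := @exists_line_4_nonlonely _ _
    (fst : hamming2 q -> 'Z_q) (snd : hamming2 q -> 'Z_q) U.
  - by rewrite cardT.
  - exact: line_4_nonlonely_shattered co r4.
  - exact: line_4_nonlonely_shattered (coordinatesC co) r4.
by rewrite -[X in X <= _]W3; apply: leq_bigmax_cond; rewrite WU.
Qed.

(** * The extremal set *)

Lemma exists_lines_card3 (q : nat) (hq : 2 < q) :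
  exists U : {set hamming2 q}, [/\ #|U| = 3 * q,
    (forall r : 'Z_q, #|[set x in U | x.1 == r]| <= 3) &
    (forall r : 'Z_q, #|[set x in U | x.2 == r]| <= 3)].
Proof.
(* [D] is [{0, 1, 2}]. Since [2 < q], [inord] never falls back to its default value 0 here, so the
   three elements are distinct. *)
pose D : {set 'Z_q} := [set inord (val k) | k : 'I_3].
have D3 : #|D| = 3.
  rewrite card_imset ?card_ord // => i j /(congr1 val) /=.
  have ltq (k : 'I_3) : k < (Zp_trunc q).+2.
    by rewrite Zp_cast ?(ltnW hq) //; apply: leq_trans (ltn_ord k) hq.
  by rewrite !inordK // => /val_inj.
(* This shear sends [(i, d)] to [(i, i + d)], so that each line in either direction is met once for
   each [d] in [D]. *)
pose h (x : hamming2 q) : hamming2 q := (x.1, (x.1 + x.2)%R).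
have hinj : injective h.
  by move=> [a b] [c d] /[dup] /(congr1 fst) /= -> /(congr1 snd) /= /GRing.addrI ->.
exists (h @: setX setT D); split=> [|r|r].
- by rewrite card_imset // cardsX cardsT D3 card_ord Zp_cast ?(ltnW hq) // mulnC.
- rewrite -D3 -(card_imset D (_ : injective (fun d : 'Z_q => (r, (r + d)%R) : hamming2 q))).
    apply/subset_leq_card/subsetP => x; rewrite inE => /andP[/imsetP[[a d]]].
    rewrite inE /= => /andP[_ dD] -> /eqP /= <-; exact: imset_f.
  by move=> a b /(congr1 snd) /= /GRing.addrI.
- rewrite -D3 -(card_imset D (_ : injective (fun d : 'Z_q => ((r - d)%R, r) : hamming2 q))).
    apply/subset_leq_card/subsetP => x; rewrite inE => /andP[/imsetP[[a d]]].
    rewrite inE /= => /andP[_ dD] -> /eqP /= <-; apply/imsetP; exists d => //.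
    by rewrite /h /= GRing.addrK.
  by move=> a b /(congr1 fst) /= /GRing.addrI /GRing.oppr_inj.
Qed.

Theorem theorem1p3 (q : nat) (hq : 4 <= q) :
  (forall U : {set hamming2 q}, 3 * q + 1 <= #|U| ->
     vcdim U (nbhds (@hamming2_adj q) U) = 3) /\
  (exists U : {set hamming2 q}, #|U| = 3 * q /\
     vcdim U (nbhds (@hamming2_adj q) U) < 3).
Proof.
split=> [U Ugt|].
  by apply: vcdim_hamming2_gt; [apply: leq_trans hq | rewrite addn1 in Ugt].
have [U [UE U1 U2]] := exists_lines_card3 q (ltnW hq).
by exists U; split; last exact: vcdim_lines_le3.
Qed.
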